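(* For every graph $H$ with $c_f(H)>\frac{2}{3}\mathsf{v}(H)$, we have $c_f(H)=c_T(H)$.
   Context: All graphs are finite and simple; $\mathsf{d}(G)=\mathsf{e}(G)/\mathsf{v}(G)$; $\tau(H)$ is the minimum size of a vertex cover of $H$; for $k\in\mathbb{N}$, $\alpha_k(H)$ is the maximum $|X|$ over $X\subseteq V(H)$ with $\chi(H[X])\le k$. Define $c_T(H)=\sup\left(\{\tau(H)\}\cup\left\{\frac{i-1}{i}\left(\mathsf{v}(H)-\frac{\alpha_i(H)}{2}\right): i\ge 2\right\}\right)$. A jumbled model of $H$ in $G$ is a map $\mu$ from $V(H)$ to subsets of $V(G)$ such that each $G[\mu(v)]$ is connected (and nonempty) and for every edge $uv\in E(H)$ some edge of $G$ joins $\mu(u)$ and $\mu(v)$ (overlaps allowed); $\mu^{\#}(x)=|\{v:x\in\mu(v)\}|$ for $x\in V(G)$. $\mathrm{Vol}_H(G)$ is the supremum of $\sum_i\alpha_i$ over finitely many reals $\alpha_i\ge0$ and jumbled models $\mu_i$ of $H$ in $G$ with $\sum_i\alpha_i\mu_i^{\#}(x)\le1$ for all $x$. The fractional extremal function is $c_f(H)=\sup_G\mathsf{d}(G)/\mathrm{Vol}_H(G)$ over non-null graphs $G$. *)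

(* Defs.v *)
From HB Require Import structures.
From mathcomp Require Import all_boot all_order all_algebra.
From mathcomp Require Import classical_sets reals constructive_ereal ereal.
Set Implicit Arguments.
Unset Strict Implicit.
Unset Printing Implicit Defensive.
Import Order.TTheory GRing.Theory Num.Theory.

Local Open Scope nat_scope.

Record sgraph := SGraph {
  vertex :> finType;
  adj : rel vertex;
  adj_sym : symmetric adj;
  adj_irrefl : irreflexive adj }.

Definition edge_set (G : sgraph) : {set {set G}} :=
  [set e | [exists x : G, exists y : G, adj x y && (e == [set x; y])]].

Definition num_vertices (G : sgraph) : nat := #|G|.
Definition num_edges (G : sgraph) : nat := #|edge_set G|.

Section Induced.
Variables (G : sgraph) (X : {set G}).

Definition induced_adj : rel {x : G | x \in X} :=
  fun x y => adj (val x) (val y).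

Lemma induced_adj_sym : symmetric induced_adj.
Proof. by move=> x y; apply: adj_sym. Qed.

Lemma induced_adj_irrefl : irreflexive induced_adj.
Proof. by move=> x; apply: adj_irrefl. Qed.

Definition induced : sgraph := SGraph induced_adj_sym induced_adj_irrefl.
End Induced.

Definition connected_graph (G : sgraph) : bool :=
  [forall x : G, forall y : G, connect (@adj G) x y].

Definition vertex_cover (G : sgraph) (X : {set G}) : bool :=
  [forall x : G, forall y : G, adj x y ==> (x \in X) || (y \in X)].

Definition tau (G : sgraph) : nat :=
  #|[arg min_(X < [set: G] | vertex_cover X) #|X|]|.

Definition colorable (G : sgraph) (k : nat) : bool :=
  [exists f : {ffun G -> 'I_k},
    [forall x : G, forall y : G, adj x y ==> (f x != f y)]].

Lemma exists_colorable (G : sgraph) : exists k, colorable G k.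
Proof.
exists #|G|; apply/existsP; exists [ffun x => enum_rank x].
apply/forallP => x; apply/forallP => y; apply/implyP => xy.
rewrite !ffunE; apply/eqP => /enum_rank_inj eq_xy.
by rewrite eq_xy adj_irrefl in xy.
Qed.

Definition chromatic_number (G : sgraph) : nat := ex_minn (exists_colorable G).

Definition alpha (k : nat) (G : sgraph) : nat :=
  \max_(X : {set G} | chromatic_number (induced X) <= k) #|X|.

Definition jumbled_model (H G : sgraph) (mu : {ffun H -> {set G}}) : Prop :=
  (forall v : H, mu v != finset.set0 /\ connected_graph (induced (mu v))) /\
  (forall u v : H, adj u v ->
     exists x y : G, [/\ x \in mu u, y \in mu v & adj x y]).

Definition multiplicity (H G : sgraph) (mu : {ffun H -> {set G}}) (x : G) : nat :=
  #|[set v : H | x \in mu v]|.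

Section Extremal.
Variable R : realType.
Local Open Scope classical_set_scope.
Local Open Scope ring_scope.

Definition density (G : sgraph) : R := (num_edges G)%:R / (num_vertices G)%:R.

Definition Vol (H G : sgraph) : \bar R :=
  ereal_sup [set t | exists (n : nat) (a : 'I_n -> R)
                            (mu : 'I_n -> {ffun H -> {set G}}),
    [/\ forall i, 0 <= a i,
        forall i, jumbled_model (mu i),
        forall x : G, \sum_i a i * (multiplicity (mu i) x)%:R <= 1
      & t = (\sum_i a i)%:E]].

(* Only two degenerate quotients occur: d / +oo = 0, when H has no vertices, and
   0 / 0 = 0 in the library's convention, when G has no edges but H does.  The
   latter leaves the supremum unchanged, since every quotient is nonnegative.
   The image notation [set _ | G in _] is avoided because sgraph does not fit
   in the universe of classical sets. *)
Definition c_f (H : sgraph) : \bar R :=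
  ereal_sup [set t | exists G : sgraph,
    (0 < num_vertices G)%N /\ t = ((density G)%:E / Vol H G)%E].

Definition c_T (H : sgraph) : \bar R :=
  ereal_sup ([set ((tau H)%:R)%:E] `|`
    [set ((i%:R - 1) / i%:R * ((num_vertices H)%:R - (alpha i H)%:R / 2))%:E
    | i in [set i : nat | (2 <= i)%N]]).
End Extremal.

(* Main.v *)
(**
  For a weight w on V(G) write w(mu) = sum_v w(mu(v)).  By the Farkas lemma,
  c_f(H) <= C amounts to  m e(G) <= C v(G) w(V(G))  whenever w >= 0 and every
  model mu of H in G has w(mu) >= m.  Put masses p_x on the vertices and ask for
    m sum_{xy in E} p_x p_y <= C (sum p) (sum p w);
  moving mass between nonadjacent vertices changes both sides affinely, so p may
  be assumed to live on a clique.  In a clique, an induced j-colourable subgraph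
  of H can be mapped to single vertices, one per colour, and the rest of H to
  the pair {x1, x2} of lightest vertices.  Two families suffice:
  (a) the complement of a minimum vertex cover goes to x1:
        m <= v(H) w_1 + tau(H) w_2;
  (b) an alpha_j-set is spread uniformly over a j-subset S of the support.
  If p_1 <= (sum p) / 3, one averages (b) over the level sets S of p, sampled by
  taking the larger of two independent draws; with this law the sum over edges
  becomes the average of (1 - 1/|S|)/2, and each S contributes at most C
  because C >= (1 - 1/j)(v(H) - alpha_j(H)/2) and C >= 2 v(H)/3.  If p_1 is
  larger, the inequality is convex in p_1, and (a) shows that its slope is
  nonnegative at p_1 = (sum p) / 3.  The lower bounds come from complete graphs
  with uniform weight and from stars with weight on the centre.
*)
Require Import Defs.
From HB Require Import structures.
From mathcomp Require Import all_boot all_order all_algebra.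
From mathcomp Require Import boolp classical_sets reals constructive_ereal ereal.
From mathcomp Require Import ring lra.
Set Implicit Arguments.
Unset Strict Implicit.
Unset Printing Implicit Defensive.
Import Order.TTheory GRing.Theory Num.Theory.
Local Open Scope ring_scope.

(** * Linear duality and level sets *)

(** Induction on the list of constraints. If [i0] cannot be dropped, some [z] satisfies the other
    constraints while [g] is positive at [z]; subtracting multiples of [a i0] makes all forms vanish
    at [z], and the induction hypothesis applies to them. *)
Lemma farkas (R : realFieldType) (T I : finType) (r : seq I)
    (a : I -> T -> R) (g : T -> R) :
  uniq r ->
  (forall x : T -> R, (forall i, i \in r -> \sum_t a i t * x t <= 0) ->
     \sum_t g t * x t <= 0) ->
  exists2 u : I -> R, forall i, 0 <= u i
    & forall t, g t = \sum_(i <- r) u i * a i t.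
Proof.
elim: r a g => [|i0 r IHr] a g /= => [_ gle|/andP[i0r ur] gle].
  exists (fun=> 0) => // t; rewrite big_nil.
  have g0 : \sum_t g t * g t = 0.
    by apply/le_anti; rewrite gle//= sumr_ge0// => i _; rewrite -expr2 sqr_ge0.
  have /eqP := psumr_eq0P (fun i _ => sqr_ge0 (g i)) g0 (isT : xpredT t).
  by rewrite mulf_eq0 orbb => /eqP.
have [gle'|] := pselect (forall x : T -> R,
    (forall i, i \in r -> \sum_t a i t * x t <= 0) -> \sum_t g t * x t <= 0).
  have [u u0 gE] := IHr a g ur gle'.
  exists (fun i => if i == i0 then 0 else u i) => [i|t]; first by case: ifP.
  rewrite big_cons eqxx mul0r add0r gE; apply: eq_big_seq => i ir.
  by case: eqP => // ii0; rewrite -ii0 ir in i0r.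
move=> /existsNP[z /not_implyP[az /negP]]; rewrite -ltNge => gz.
have az0 : 0 < \sum_t a i0 t * z t.
  rewrite ltNge; apply: contraTN gz => az0; rewrite -leNgt; apply: gle => i.
  by rewrite inE => /orP[/eqP->//|/az].
set c := \sum_t a i0 t * z t in az0.
have lin (f : T -> R) (k : R) (x y : T -> R) :
    \sum_t f t * (x t - k * y t) = \sum_t f t * x t - k * \sum_t f t * y t.
  rewrite mulr_sumr -sumrB; apply: eq_bigr => t _; ring.
have lin' (f h : T -> R) (k : R) (x : T -> R) :
    \sum_t (f t - k * h t) * x t = \sum_t f t * x t - k * \sum_t h t * x t.
  rewrite mulr_sumr -sumrB; apply: eq_bigr => t _; ring.
pose k i := (\sum_t a i t * z t) / c.
pose kg := (\sum_t g t * z t) / c.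
have [||u u0 gE] := IHr (fun i t => a i t - k i * a i0 t)
    (fun t => g t - kg * a i0 t).
- exact: ur.
- move=> x ax; rewrite lin'.
  have /(_ _)/wrap[] := gle (fun t => x t - (\sum_t a i0 t * x t) / c * z t).
    move=> i; rewrite inE lin => /orP[/eqP->|ir].
      by rewrite -/c divfK ?subrr// gt_eqF.
    by have := ax i ir; rewrite lin' /k mulrAC -mulrA mulrC.
  by rewrite lin /kg mulrAC -mulrA mulrC.
(* The coefficient of [i0] is nonnegative because [k i <= 0] on [r] and [kg > 0]. *)
exists (fun i => if i == i0 then kg - \sum_(i <- r) u i * k i else u i) => [i|t].
  case: ifP => // _; rewrite subr_ge0 (@le_trans _ _ 0)//.
    rewrite big_seq; apply: sumr_le0 => j jr.
    by rewrite mulr_ge0_le0// /k mulr_le0_ge0 ?az// invr_ge0 ltW.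
  by rewrite /kg divr_ge0// ltW.
rewrite big_cons eqxx.
rewrite [X in _ = _ + X](eq_big_seq
  (fun i => u i * (a i t - k i * a i0 t) + u i * k i * a i0 t)).
  rewrite big_split/= -gE -mulr_suml; ring.
move=> i ir; case: eqP => [ii0|_]; first by rewrite -ii0 ir in i0r.
ring.
Qed.

(* Peel off the constant [min p] on the support of [p] and induct: this writes
   [p] as a mixture of uniform distributions on nested sets, and [nu] is the law
   of the larger of two independent sets drawn from that mixture. *)
Lemma layers (R : realFieldType) (T : finType) (p : T -> R) :
  (forall i, 0 <= p i) ->
  exists nu : {set T} -> R,
    [/\ forall S, 0 <= nu S,
        forall S, nu S != 0 -> (0 < #|S|)%N /\ forall i, i \in S -> 0 < p i,
        \sum_S nu S = (\sum_i p i) ^+ 2,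
        \sum_S nu S / #|S|%:R = \sum_i p i ^+ 2
      & forall i, \sum_(S : {set T} | i \in S) nu S / #|S|%:R <= 2 * p i * \sum_i p i].
Proof.
have [k] := ubnP #|[set i | 0 < p i]|; elim: k p => // k IHk p.
set K := [set i | 0 < p i] => Kk p0.
have pK i : (i \notin K) -> p i = 0.
  by rewrite inE -leNgt => pi; apply/le_anti; rewrite pi p0.
have [K0|[i0 i0K]] := finset.set_0Vmem K.
  have pz i : p i = 0 by apply: pK; rewrite K0 inE.
  have pz1 : \sum_i p i = 0 by rewrite big1.
  exists (fun=> 0); split => // [S|||i]; first by rewrite eqxx.
  - by rewrite big1// pz1 expr0n.
  - by rewrite !big1// => i _; rewrite ?mul0r// pz expr0n.
  - by rewrite pz1 mulr0 big1// => S _; rewrite mul0r.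
pose i1 := [arg min_(i < i0 in K) p i]%O.
have [i1K i1min] : i1 \in K /\ forall i, i \in K -> p i1 <= p i.
  by rewrite /i1; case: arg_minP.
pose q i := p i - (i \in K)%:R * p i1.
have q0 i : 0 <= q i.
  rewrite /q; case: (boolP (i \in K)) => iK; last by rewrite mul0r subr0.
  by rewrite mul1r subr_ge0 i1min.
have qp i : 0 < q i -> i \in K.
  by apply: contraTT => iK; rewrite /q (negbTE iK) mul0r subr0 (pK _ iK) ltxx.
have [||nu [nu0 nus nu1 nu2 nu3]] := IHk q.
- apply: leq_trans (_ : (#|K| <= k)%N) => //; apply: proper_card.
  apply/properP; split; first by apply/fintype.subsetP => i; rewrite inE; exact: qp.
  by exists i1 => //; rewrite inE /q i1K mul1r subrr ltxx.
- exact: q0.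
set t := p i1 in i1min q q0 qp nu1 nu2 nu3 nus *.
have t0 : 0 < t by rewrite inE in i1K.
set s := \sum_i q i in nu1 nu3.
have s0 : 0 <= s by apply: sumr_ge0.
pose N : R := #|K|%:R.
have N0 : 0 < N by rewrite ltr0n; apply/card_gt0P; exists i0.
have NE : N = \sum_i (i \in K)%:R.
  by rewrite /N -sum1_card natr_sum big_mkcond; apply: eq_bigr => i _; case: ifP.
have pE i : p i = q i + (i \in K)%:R * t by rewrite /q subrK.
have sE : \sum_i p i = s + N * t.
  by under eq_bigr do rewrite pE; rewrite big_split/= -mulr_suml NE.
have ssE : \sum_i p i ^+ 2 = \sum_i q i ^+ 2 + 2 * t * s + N * t ^+ 2.
  rewrite NE mulr_sumr mulr_suml -!big_split/=; apply: eq_bigr => i _; rewrite pE.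
  case: (boolP (i \in K)) => iK /=; first ring.
  have -> : q i = 0.
    by apply/eqP; rewrite eq_le q0 andbT leNgt; apply: contra iK => /qp.
  ring.
(* [K] contains every set used for [q], so the larger of two draws is [K] unless both come from [q]:
   [K] receives [(s + N t)^2 - s^2]. *)
pose d := 2 * N * t * s + N ^+ 2 * t ^+ 2.
have d0 : 0 <= d by rewrite /d; have := mulr_ge0 (ltW t0) s0; nra.
have dN : d / N = 2 * t * s + N * t ^+ 2.
  by rewrite /d; field; rewrite gt_eqF.
have sumK (F : {set T} -> R) (c : R) (P : pred {set T}) :
    \sum_(S | P S) (F S + (S == K)%:R * c) = \sum_(S | P S) F S + (P K)%:R * c.
  rewrite big_split/=; congr (_ + _).
  case: (boolP (P K)) => PK.
    rewrite (bigD1 K)//= eqxx big1 ?addr0// => S /andP[_ /negbTE->].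
    by rewrite mul0r.
  rewrite mul0r big1// => S PS; case: eqP => [SK|_]; last by rewrite mul0r.
  by rewrite SK (negbTE PK) in PS.
have nuN S : (nu S + (S == K)%:R * d) / #|S|%:R
    = nu S / #|S|%:R + (S == K)%:R * (d / N).
  by rewrite mulrDl; case: eqP => [->|]; rewrite ?mul1r// !mul0r.
exists (fun S => nu S + (S == K)%:R * d); split.
- by move=> S; rewrite addr_ge0// mulr_ge0.
- move=> S; case: (eqVneq S K) => [-> _|_].
    by split => [|i]; rewrite ?inE//; apply/card_gt0P; exists i0.
  rewrite mul0r addr0 => /nus[S0 qS]; split=> // i /qS /qp; by rewrite inE.
- rewrite (sumK nu d xpredT) nu1 sE /d /=; ring.
- under eq_bigr do rewrite nuN.
  rewrite (sumK (fun S => nu S / #|S|%:R) _ xpredT) nu2 ssE dN /=; ring.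
- move=> i; under eq_bigr do rewrite nuN.
  rewrite (sumK (fun S => nu S / #|S|%:R) _ (fun S => i \in S)) sE dN pE.
  have st0 := mulr_ge0 (ltW t0) s0; have Nt0 := mulr_ge0 (ltW N0) (ltW t0).
  have qN0 := mulr_ge0 (q0 i) Nt0; have tN0 := mulr_ge0 (ltW t0) Nt0.
  have := nu3 i; case: (i \in K) => /=; lra.
Qed.

(** * The weighted inequality on a clique *)

(** Half of the right side gives each vertex [i] a budget [C s p i]. Averaged over [nu], the
    coloured parts use [r i] of it, and the remainder [d i] has to pay for what is sent to the pair
    [x1], [x2]. *)
Lemma mixture_bound (R : realFieldType) (T : finType) (p w : T -> R)
    (alpha : nat -> R) (n C m : R) (x1 x2 : T) :
  (forall i, 0 <= p i) -> 0 <= w x1 -> 0 <= C -> 2 * n <= 3 * C ->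
  w x1 <= w x2 -> (forall i, 0 < p i -> i != x1 -> w x2 <= w i) ->
  m <= n * (w x1 + w x2) ->
  (forall S : {set T}, (forall i, i \in S -> 0 < p i) ->
     #|S|%:R * m <= alpha #|S| * \sum_(i in S) w i
                    + #|S|%:R * (n - alpha #|S|) * (w x1 + w x2)) ->
  (forall j, (2 <= j)%N -> (1 - j%:R^-1) * (n - alpha j / 2) <= C) ->
  3 * p x1 <= \sum_i p i ->
  m * ((\sum_i p i) ^+ 2 - \sum_i p i ^+ 2)
    <= 2 * C * (\sum_i p i) * \sum_i p i * w i.
Proof.
move=> p0 w10 C0 nC w12 w2min mpair mset Calpha p1.
have [nu [nu0 nus nu1 nu2 nu3]] := layers p0.
set s := \sum_i p i in p1 nu1 nu3 *.
set s2 := \sum_i p i ^+ 2 in nu2 *.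
set D := w x1 + w x2 in mpair mset.
(* Only part of the alpha_j-set is coloured: [kap S] is the least amount that
   keeps the total cost of [S] below [C]; it is at most [C / 2] as [2 n <= 3 C]. *)
pose kap (S : {set T}) := Num.max 0 (n * (1 - #|S|%:R^-1) - C).
have kap0 (S : {set T}) : 0 <= kap S by rewrite le_max lexx.
have card1 (S : {set T}) : (0 < #|S|)%N -> 0 < (#|S|%:R^-1 : R) <= 1.
  by move=> S0; rewrite invr_gt0 ltr0n S0 invf_le1 ?ler1n ?ltr0n.
have kapC (S : {set T}) : (0 < #|S|)%N -> kap S <= C / 2.
  by move=> /card1 S1; rewrite ge_max; apply/andP; split; nra.
have kap_tot (S : {set T}) : n * (1 - #|S|%:R^-1) - C <= kap S by rewrite le_max lexx orbT.
have mkap (S : {set T}) : (0 < #|S|)%N -> (forall i, i \in S -> 0 < p i) ->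
    (1 - #|S|%:R^-1) * m <= 2 * kap S * ((\sum_(i in S) w i) / #|S|%:R)
                       + (n * (1 - #|S|%:R^-1) - 2 * kap S) * D.
  move=> S0 pS; have S1 := card1 S S0.
  have : m <= alpha #|S| * ((\sum_(i in S) w i) / #|S|%:R) + (n - alpha #|S|) * D.
    rewrite -(ler_pM2l (_ : 0 < #|S|%:R)) ?ltr0n//; apply: (le_trans (mset S pS)).
    rewrite le_eqVlt; apply/orP; left; apply/eqP; field.
    by rewrite pnatr_eq0 -lt0n.
  set av := (\sum_(i in S) w i) / _ => mS.
  (* When [kap S] is positive, [Calpha] leaves room to colour that much; a singleton has
     [kap S = 0]. *)
  have : kap S = 0 \/ 2 * kap S <= (1 - #|S|%:R^-1) * alpha #|S| /\ 0 <= kap S.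
    have [S2|] := leqP 2 #|S|.
      have := Calpha _ S2; rewrite /kap maxEle; case: ifP => [h hC|]; last by left.
      by right; split; lra.
    move=> S2; left; rewrite /kap; have -> : #|S| = 1%N by apply/eqP; rewrite eqn_leq S0 andbT.
    by rewrite invr1 subrr mulr0 sub0r; apply/max_idPl; rewrite oppr_le0.
  move: (#|S|%:R^-1) (kap S) (alpha #|S|) S1 mS => c k a c1 mS [->|[ka k0]].
    by rewrite mulr0 mul0r add0r subr0; nra.
  (* If [S] is on average cheaper than the pair, colouring less than the full [alpha]-set only
     raises the cost; otherwise the uncoloured bound [m <= n D] is enough. *)
  have [avD|Dav] := leP av D.
    have h1 : (1 - c) * m <= (1 - c) * (a * av + (n - a) * D).
      by rewrite ler_wpM2l//; lra.
    have : 0 <= ((1 - c) * a - 2 * k) * (D - av) by rewrite mulr_ge0; lra.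
    lra.
  have h1 : (1 - c) * m <= (1 - c) * (n * D) by rewrite ler_wpM2l//; lra.
  have : 0 <= k * (av - D) by rewrite mulr_ge0; lra.
  lra.
pose r i := \sum_(S : {set T} | i \in S) nu S * kap S / #|S|%:R.
have exch (f : T -> R) : \sum_S nu S * kap S * ((\sum_(i in S) f i) / #|S|%:R)
    = \sum_i r i * f i.
  under eq_bigr => S _ do rewrite mulrCA mulr_suml.
  rewrite [RHS](eq_bigr (fun i => \sum_(S : {set T} | i \in S)
    f i * (nu S * kap S / #|S|%:R))); last first.
    by move=> i _; rewrite /r mulrC mulr_sumr.
  by rewrite [RHS](exchange_big_dep xpredT).
set k := \sum_S nu S * kap S.
have rtot : \sum_i r i = k.
  rewrite (eq_bigr (fun i => r i * 1)) => [|i _]; last by rewrite mulr1.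
  rewrite -(exch (fun=> 1)); apply: eq_bigr => S _.
  have [->|/nus[S0 _]] := eqVneq (nu S) 0; first by rewrite !mul0r.
  by rewrite sumr_const divff ?mulr1// pnatr_eq0 -lt0n.
have r0 i : 0 <= r i.
  by apply: sumr_ge0 => S _; rewrite mulr_ge0 ?invr_ge0 ?ler0n ?mulr_ge0.
have rC i : r i <= C * s * p i.
  apply: (@le_trans _ _ (C / 2 * \sum_(S : {set T} | i \in S) nu S / #|S|%:R)).
    rewrite mulr_sumr ler_sum// => S iS.
    rewrite mulrAC mulrC ler_wpM2r ?mulr_ge0 ?invr_ge0//.
    by apply: kapC; apply/card_gt0P; exists i.
  have := nu3 i; nra.
pose E := s ^+ 2 - s2.
have EE : E = \sum_S nu S * (1 - #|S|%:R^-1).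
  by rewrite /E -nu1 -nu2 -sumrB; apply: eq_bigr => S _; rewrite mulrBr mulr1.
have h1 : m * E <= 2 * \sum_i r i * w i + (n * E - 2 * k) * D.
  rewrite -exch EE !mulr_sumr mulrBl !mulr_suml -sumrB -big_split/= ler_sum// => S _.
  have [->|/nus[S0 pS]] := eqVneq (nu S) 0; first by rewrite !(mul0r, mulr0) subrr addr0.
  have := ler_wpM2l (nu0 S) (mkap S S0 pS); lra.
have h2 : n * E - k <= C * s ^+ 2.
  rewrite EE -nu1 !mulr_sumr -sumrB ler_sum// => S _.
  have := ler_wpM2l (nu0 S) (kap_tot S); lra.
have s0 : 0 <= s by apply: sumr_ge0.
pose d i := C * s * p i - r i.
have d0 i : 0 <= d i by rewrite subr_ge0.
have dtot : \sum_i d i = C * s ^+ 2 - k.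
  by rewrite sumrB rtot -mulr_sumr -/s -mulrA -expr2.
(* For a fixed share of [x1], the remainder weighs least when all the rest has weight [w x2]. *)
have h3 : d x1 * w x1 + (C * s ^+ 2 - k - d x1) * w x2 <= \sum_i d i * w i.
  rewrite -dtot (bigD1 x1)//= [X in _ <= X](bigD1 x1)//= lerD2l.
  rewrite addrAC subrr add0r mulr_suml ler_sum// => i i1.
  have [pi|pi] := ltP 0 (p i); first by rewrite ler_wpM2l// w2min.
  have pi0 : p i = 0 by apply/le_anti; rewrite pi p0.
  have di : d i = 0 by apply/le_anti; rewrite d0 /d pi0 mulr0 sub0r oppr_le0 r0.
  by rewrite di !mul0r.
have dw : \sum_i d i * w i = C * s * (\sum_i p i * w i) - \sum_i r i * w i.
  rewrite mulr_sumr -sumrB; apply: eq_bigr => i _; rewrite /d; ring.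
have Es : E <= s ^+ 2 - p x1 ^+ 2.
  rewrite lerD2l lerN2 /s2 (bigD1 x1)//= lerDl sumr_ge0// => i _; exact: sqr_ge0.
have d1 : d x1 <= C * s * p x1 by rewrite gerBl.
have E0 : 0 <= E.
  rewrite EE sumr_ge0// => S _; have [->|/nus[/card1 S0 _]] := eqVneq (nu S) 0.
    by rewrite mul0r.
  by rewrite mulr_ge0//; lra.
(* Here [3 p x1 <= s] enters: the bounds on [n E] and [d x1] leave at least
   [C (s - p x1) (s - 3 p x1) / 2]. *)
have c2 : 0 <= 2 * C * s ^+ 2 - 2 * d x1 - n * E.
  have : n * E <= 3 / 2 * C * (s ^+ 2 - p x1 ^+ 2).
    apply: (@le_trans _ _ (3 / 2 * C * E)); first by rewrite ler_wpM2r//; lra.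
    by rewrite ler_wpM2l// mulr_ge0.
  have : 0 <= C * ((s - p x1) * (s - 3 * p x1)).
    by have := p0 x1; rewrite !mulr_ge0//; lra.
  lra.
rewrite -/E -/D in h1 *.
(* Writing [w x2 = w x1 + (w x2 - w x1)] splits the claim into [h2] times [w x1] and [c2] times the
   difference. *)
have := mulr_ge0 c2 (_ : 0 <= w x2 - w x1).
have := mulr_ge0 (_ : 0 <= C * s ^+ 2 - (n * E - k)) w10.
rewrite !subr_ge0 => /(_ h2) h4 /(_ w12) h5.
rewrite /D in h1; lra.
Qed.

(** When the lightest vertex [x1] holds over a third of the mass, right side minus left side is
    quadratic in [p x1] with leading coefficient [2 C w x1 >= 0]. A nonnegative chord slope then
    carries the inequality over from [mixture_bound]. *)
Lemma clique_bound (R : realFieldType) (T : finType) (p w : T -> R)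
    (alpha : nat -> R) (n tau C m : R) :
  (forall i, 0 <= p i) -> (forall i, 0 <= w i) ->
  0 <= tau -> tau <= n -> tau <= C -> 2 * n <= 3 * C ->
  (forall j, (2 <= j)%N -> (1 - j%:R^-1) * (n - alpha j / 2) <= C) ->
  (forall x y, 0 < p x -> 0 < p y -> x != y -> m <= n * w x + tau * w y) ->
  (forall x y (S : {set T}), 0 < p x -> 0 < p y -> x != y ->
     (forall i, i \in S -> 0 < p i) ->
     #|S|%:R * m <= alpha #|S| * \sum_(i in S) w i
                    + #|S|%:R * (n - alpha #|S|) * (w x + w y)) ->
  m * ((\sum_i p i) ^+ 2 - \sum_i p i ^+ 2)
    <= 2 * C * (\sum_i p i) * \sum_i p i * w i.
Proof.
move=> p0 w0 tau0 taun tauC nC Calpha mpair mset.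
have C0 : 0 <= C by exact: le_trans tauC.
have rhs0 : 0 <= 2 * C * (\sum_i p i) * \sum_i p i * w i.
  rewrite mulr_ge0 ?mulr_ge0//; first exact: sumr_ge0.
  by apply: sumr_ge0 => i _; rewrite mulr_ge0.
have pK (K : {set T}) : K = finset.set0 -> K = [set i | 0 < p i] -> forall i, p i = 0.
  move=> -> /setP K0 i; have := K0 i; rewrite !inE => /esym/negbT; rewrite -leNgt => pi.
  by apply/le_anti; rewrite pi p0.
have [K0|[i0 i0K]] := finset.set_0Vmem [set i | 0 < p i].
  have p_0 := pK _ K0 (erefl _).
  by rewrite !big1// => [|i _|i _]; rewrite ?p_0 ?expr0n ?mul0r//= subrr !mulr0.
have [x1 p1 w1min] : exists2 x, 0 < p x & forall i, 0 < p i -> w x <= w i.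
  exists [arg min_(i < i0 in [set i | 0 < p i]) w i]%O; case: arg_minP => // x.
    by rewrite inE.
  by move=> _ wx i pi; apply: wx; rewrite inE.
have sumD1 (f : T -> R) : \sum_i f i = f x1 + \sum_(i | i != x1) f i.
  by rewrite (bigD1 x1).
have [|[j0 j0K]] := finset.set_0Vmem [set i | (i != x1) && (0 < p i)].
  move=> /setP K0; have p_0 i : i != x1 -> p i = 0.
    move=> i1; have := K0 i; rewrite !inE i1 /= => /negbT; rewrite -leNgt => pi.
    by apply/le_anti; rewrite pi p0.
  rewrite !sumD1 !big1 ?addr0 => [|i /p_0->|i /p_0->|i /p_0->]; rewrite ?mul0r ?expr0n//.
  move: rhs0; rewrite !sumD1 !big1 ?addr0 => [|i /p_0->|i /p_0->]; rewrite ?mul0r//.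
  by rewrite subrr mulr0.
have [x2 [x21 p2 w2min]] : exists x, [/\ x != x1, 0 < p x &
    forall i, 0 < p i -> i != x1 -> w x <= w i].
  exists [arg min_(i < j0 in [set i | (i != x1) && (0 < p i)]) w i]%O.
  case: arg_minP => // x; rewrite inE => /andP[xx1 px] wx.
  by split => // i pi i1; apply: wx; rewrite inE i1.
have w12 : w x1 <= w x2 by apply: w1min.
have m12 : m <= n * w x1 + tau * w x2 by apply: mpair => //; rewrite eq_sym.
have mD : m <= n * (w x1 + w x2) by have := ler_wpM2r (w0 x2) taun; lra.
have x12 : x1 != x2 by rewrite eq_sym.
have [p13|] := leP (3 * p x1) (\sum_i p i).
  apply: (@mixture_bound _ _ p w alpha n C m x1 x2) => // S pS.
  exact: mset.
set P := \sum_(i | i != x1) p i.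
have pPE : \sum_i p i = p x1 + P := sumD1 _.
have P0 : 0 < P.
  rewrite /P (bigD1 x2)//=; apply: ltr_wpDr => //.
  by apply: sumr_ge0 => i _; apply: p0.
rewrite pPE => p13.
(* Lower the mass of [x1] to a third of the new total. *)
pose q i := if i == x1 then P / 2 else p i.
have q1 : q x1 = P / 2 by rewrite /q eqxx.
have qE i : i != x1 -> q i = p i by rewrite /q => /negbTE->.
have qp i : 0 < q i -> 0 < p i by rewrite /q; case: eqP => // ->.
have sq : \sum_i q i = P / 2 + P by rewrite sumD1 q1 (eq_bigr _ qE).
have sq2 : \sum_i q i ^+ 2 = (P / 2) ^+ 2 + \sum_(i | i != x1) p i ^+ 2.
  by rewrite sumD1 q1; congr (_ + _); apply: eq_bigr => i /qE->.
have sqw : \sum_i q i * w i = P / 2 * w x1 + \sum_(i | i != x1) p i * w i.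
  by rewrite sumD1 q1; congr (_ + _); apply: eq_bigr => i /qE->.
have := @mixture_bound _ _ q w alpha n C m x1 x2.
rewrite sq sq2 sqw (sumD1 (fun i => p i ^+ 2)) (sumD1 (fun i => p i * w i)).
set P2 := \sum_(i | _) p i ^+ 2; set W := \sum_(i | _) p i * w i => mix.
have {mix} : m * ((P / 2 + P) ^+ 2 - ((P / 2) ^+ 2 + P2)) <=
    2 * C * (P / 2 + P) * (P / 2 * w x1 + W).
  apply: mix => //.
  - by move=> i; rewrite /q; case: eqP => // _; rewrite divr_ge0// ltW.
  - by move=> i /qp; apply: w2min.
  - by move=> S qS; apply: mset => // i /qS /qp.
  - by rewrite q1; lra.
have WP : P * w x2 <= W.
  rewrite mulr_suml ler_sum// => i i1.
  have [pi|pi] := ltP 0 (p i); first by rewrite ler_wpM2l// w2min.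
  have -> : p i = 0 by apply/le_anti; rewrite pi p0.
  by rewrite !mul0r.
(* The chord slope between [p x1] and [P / 2], up to a factor 2. *)
have slope : 0 <= C * w x1 * (p x1 + P / 2) + C * (W + P * w x1) - m * P.
  have h1 : m * P <= (3 / 2 * C * w x1 + C * w x2) * P.
    rewrite ler_wpM2r ?(ltW P0)//; apply: (le_trans m12).
    by rewrite lerD// ler_wpM2r//; lra.
  have h2 := ler_wpM2l C0 WP.
  have h3 : 0 <= C * w x1 * (2 * p x1 - P) by rewrite !mulr_ge0//; lra.
  have h4 : 0 <= C * w x1 * P by rewrite !mulr_ge0// ltW.
  lra.
have : 0 <= (p x1 - P / 2) * (C * w x1 * (p x1 + P / 2) + C * (W + P * w x1) - m * P).
  by rewrite mulr_ge0//; lra.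
lra.
Qed.

(** * Models of H in a graph *)

Lemma sum_delta (R : pzRingType) (T : finType) (f : T -> R) (x y : T) :
  \sum_z f z * ((z == x)%:R - (z == y)%:R) = f x - f y.
Proof.
have sum1 a : \sum_z f z * (z == a)%:R = f a.
  rewrite (bigD1 a)//= eqxx mulr1 big1 ?addr0// => z /negbTE->.
  by rewrite mulr0.
by under eq_bigr do rewrite mulrBr; rewrite sumrB !sum1.
Qed.

(* Zykov symmetrization. *)
Lemma clique_support (R : realFieldType) (G : sgraph) (w : G -> R) (m C : R) :
  (forall p : G -> R, (forall x, 0 <= p x) ->
     (forall x y, 0 < p x -> 0 < p y -> x != y -> adj x y) ->
     m * \sum_x p x * \sum_y (adj x y)%:R * p y
       <= 2 * C * (\sum_x p x) * \sum_x p x * w x) ->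
  forall p : G -> R, (forall x, 0 <= p x) ->
     m * \sum_x p x * \sum_y (adj x y)%:R * p y
       <= 2 * C * (\sum_x p x) * \sum_x p x * w x.
Proof.
move=> clique p; have [k] := ubnP #|[set x | 0 < p x]|.
elim: k p => // k IHk p pk p0.
have [[x y] /and4P[/= px py xy Nxy]|cl] :=
    pickP [pred xy : G * G | [&& 0 < p xy.1, 0 < p xy.2, xy.1 != xy.2
                               & ~~ adj xy.1 xy.2]]; last first.
  by apply: clique => // x y px py xy; have := cl (x, y); rewrite /= px py xy => /negbFE.
(* [q s] moves mass [s] from [y] to [x]. *)
pose q s z := p z + s * ((z == x)%:R - (z == y)%:R).
pose N z := \sum_v (adj z v)%:R * p v.
have qN s z : \sum_v (adj z v)%:R * q s v = N z + s * ((adj z x)%:R - (adj z y)%:R).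
  rewrite -(sum_delta (fun v => (adj z v)%:R)) mulr_sumr -big_split/=.
  by apply: eq_bigr => v _; rewrite /q; ring.
have pN : \sum_z p z * ((adj z x)%:R - (adj z y)%:R) = N x - N y.
  rewrite /N -sumrB; apply: eq_bigr => z _.
  by rewrite ![adj z _]adj_sym; ring.
have qE s : \sum_z q s z * \sum_v (adj z v)%:R * q s v
    = \sum_z p z * N z + 2 * s * (N x - N y).
  (* The coefficient of [s^2] involves only adjacencies among [x] and [y], all absent, so the edge
     form is affine in [s]. *)
  under eq_bigr do rewrite qN.
  rewrite (eq_bigr (fun z => p z * N z
    + s * (p z * ((adj z x)%:R - (adj z y)%:R))
    + s * (N z * ((z == x)%:R - (z == y)%:R))
    + s ^+ 2 * (((adj z x)%:R - (adj z y)%:R) * ((z == x)%:R - (z == y)%:R)))).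
    rewrite !big_split/= -!mulr_sumr pN !sum_delta !adj_irrefl.
    by rewrite [adj y x]adj_sym (negbTE Nxy); ring.
  by move=> z _; rewrite /q; ring.
have qsum s : \sum_z q s z = \sum_z p z.
  rewrite big_split/= -mulr_sumr.
  have /= := sum_delta (fun=> 1 : R) x y; under eq_bigr do rewrite mul1r.
  by move=> ->; rewrite subrr mulr0 addr0.
have qw s : \sum_z q s z * w z = \sum_z p z * w z + s * (w x - w y).
  rewrite -(sum_delta w) mulr_sumr -big_split/=.
  by apply: eq_bigr => v _; rewrite /q; ring.
have qx s : q s x = p x + s by rewrite /q eqxx (negbTE xy) subr0 mulr1.
have qy s : q s y = p y - s.
  by rewrite /q eqxx eq_sym (negbTE xy) sub0r mulrN1.
have qz s z : z != x -> z != y -> q s z = p z.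
  by move=> /negbTE zx /negbTE zy; rewrite /q zx zy subrr mulr0 addr0.
have IH s z0 : 0 < p z0 -> q s z0 = 0 -> 0 <= q s x -> 0 <= q s y ->
    m * (\sum_z p z * N z + 2 * s * (N x - N y)) <=
    2 * C * (\sum_z p z) * (\sum_z p z * w z + s * (w x - w y)).
  move=> pz0 qz0 qx0 qy0; rewrite -qE -qw -(qsum s); apply: IHk; last first.
    by move=> z; have [->//|zx] := eqVneq z x; have [->//|zy] := eqVneq z y; rewrite qz.
  rewrite ltnS in pk; apply: leq_trans pk; apply: proper_card.
  apply/properP; split; last by exists z0; rewrite inE ?qz0 ?ltxx.
  apply/fintype.subsetP => z; rewrite !inE.
  by have [->//|zx] := eqVneq z x; have [->//|zy] := eqVneq z y; rewrite qz.
have h1 := IH (p y) y py; have h2 := IH (- p x) x px.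
move: h1 h2; rewrite !qx !qy !subrr opprK => /(_ erefl) h1 /(_ erefl) h2.
have {}h1 := h1 (addr_ge0 (ltW px) (ltW py)) (lexx 0).
have {}h2 := h2 (lexx 0) (addr_ge0 (ltW py) (ltW px)).
(* Weight [p x] on the shift by [p y] and weight [p y] on the shift by [- p x] cancel the terms
   linear in [s]. *)
have {h1}h1 := ler_wpM2l (ltW px) h1.
have {h2}h2 := ler_wpM2l (ltW py) h2.
rewrite -(ler_pM2l (addr_gt0 px py)) -/(N _).
move: (\sum_z p z * N z) (\sum_z p z * w z) (\sum_z p z) h1 h2 => e f s; lra.
Qed.

Lemma edge_sum_clique (R : pzRingType) (G : sgraph) (p : G -> R) :
  (forall x y, p x != 0 -> p y != 0 -> x != y -> adj x y) ->
  \sum_x p x * \sum_y (adj x y)%:R * p y = (\sum_x p x) ^+ 2 - \sum_x p x ^+ 2.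
Proof.
move=> cl; rewrite expr2 mulr_suml -sumrB; apply: eq_bigr => x _.
rewrite expr2 -mulrBr; have [->|px] := eqVneq (p x) 0; first by rewrite !mul0r.
congr (_ * _); rewrite (bigD1 x)//= [X in _ = X - _](bigD1 x)//=.
rewrite adj_irrefl mul0r add0r addrAC subrr add0r; apply: eq_bigr => y yx.
have [->|py] := eqVneq (p y) 0; first by rewrite mulr0.
by rewrite cl ?mul1r// eq_sym.
Qed.

Lemma model_weight (R : pzRingType) (H G : sgraph) (w : G -> R)
    (mu : {ffun H -> {set G}}) :
  \sum_x w x * (multiplicity mu x)%:R = \sum_v \sum_(x in mu v) w x.
Proof.
rewrite (exchange_big_dep xpredT)//=; apply: eq_bigr => x _.
rewrite sumr_const mulr_natr; congr (_ *+ _).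
by rewrite /multiplicity; apply: eq_card => v; rewrite !inE.
Qed.

Definition clique (G : sgraph) (K : {set G}) :=
  forall x y, x \in K -> y \in K -> x != y -> adj x y.

Definition proper_on (H : sgraph) (T : eqType) (A : {set H}) (f : H -> T) :=
  forall u v, u \in A -> v \in A -> adj u v -> f u != f v.

Definition coloring_model (H G : sgraph) (A : {set H}) (f : H -> G) (x y : G) :
    {ffun H -> {set G}} :=
  [ffun v => if v \in A then [set f v] else [set x; y]].

(** Nonempty subsets of a clique are connected. Two copies of the pair are joined by the edge [xy],
    and a single vertex is joined to whichever of [x], [y] differs from it. *)
Lemma coloring_modelP (H G : sgraph) (K : {set G}) (A : {set H}) (f : H -> G) (x y : G) :
  clique K -> x \in K -> y \in K -> x != y ->
  (forall v, v \in A -> f v \in K) -> proper_on A f ->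
  jumbled_model (coloring_model A f x y).
Proof.
move=> cK xK yK xy fK fA; split=> [v|u v uv]; rewrite !ffunE.
  have sub z : z \in (if v \in A then [set f v] else [set x; y]) -> z \in K.
    by case: ifP => [/fK fvK|_]; rewrite !inE; [move=> /eqP->|case/orP=> /eqP->].
  split.
    by case: ifP => _; apply/set0Pn; [exists (f v)|exists x]; rewrite !inE eqxx.
  apply/forallP => a; apply/forallP => b.
  have [->|ab] := eqVneq a b; first exact: connect0.
  apply: connect1; rewrite /induced /= /induced_adj; apply: cK.
  - exact: sub (valP a).
  - exact: sub (valP b).
  - by rewrite (inj_eq val_inj).
have [uA|uA] := boolP (u \in A); have [vA|vA] := boolP (v \in A).
- exists (f u), (f v); rewrite !inE; split=> //.
  by apply: cK; [exact: fK|exact: fK|exact: fA].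
- have [fux|fux] := eqVneq (f u) x.
    by exists (f u), y; rewrite !inE !eqxx orbT fux; split=> //; exact: cK.
  by exists (f u), x; rewrite !inE !eqxx; split=> //; apply: cK => //; exact: fK.
- have [fvx|fvx] := eqVneq (f v) x.
    exists y, (f v); rewrite !inE !eqxx orbT fvx; split=> //.
    by apply: cK => //; rewrite eq_sym.
  exists x, (f v); rewrite !inE !eqxx; split=> //.
  by apply: cK; rewrite ?fK// eq_sym.
- by exists x, y; rewrite !inE !eqxx orbT; split=> //; exact: cK.
Qed.

Lemma coloring_model_weight (R : pzRingType) (H G : sgraph) (w : G -> R)
    (A : {set H}) (f : H -> G) (x y : G) : x != y ->
  \sum_z w z * (multiplicity (coloring_model A f x y) z)%:R
  = \sum_(v in A) w (f v) + (#|H| - #|A|)%:R * (w x + w y).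
Proof.
move=> xy; rewrite model_weight (bigID (mem A))/=; congr (_ + _).
  by apply: eq_bigr => v vA; rewrite ffunE vA big_set1.
have -> : (#|H| - #|A|)%N = #|~: A| by rewrite [RHS]cardsCs finset.setCK.
rewrite -sum1_card natr_sum mulr_suml.
apply: eq_big => [v|v /negbTE vA]; first by rewrite inE.
by rewrite ffunE vA mul1r big_setU1 ?inE// big_set1.
Qed.

(** The colour type ['I_k.+1] provides a default colour outside [A] and the addition used in
    [set_model_bound] to shift colours. *)
Lemma alphaP (H : sgraph) (k : nat) : exists (A : {set H}) (f : H -> 'I_k.+1),
  #|A| = alpha k.+1 H /\ proper_on A f.
Proof.
(* The empty set qualifies, so the maximum defining [alpha] is attained. *)
have S0 : (chromatic_number (induced (finset.set0 : {set H})) <= k.+1)%N.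
  rewrite /chromatic_number; case: ex_minnP => c _ cmin.
  apply: (leq_trans (cmin 0%N _)) => //; apply/existsP.
  have vac (x : induced (finset.set0 : {set H})) : False by case: x => x; rewrite inE.
  by exists [ffun x => match vac x with end]; apply/forallP => x; case: (vac x).
have : (0 < #|[pred X : {set H} | chromatic_number (induced X) <= k.+1]|)%N.
  by apply/card_gt0P; exists finset.set0.
move=> /(@eq_bigmax_cond _ _ (fun X : {set H} => #|X|))[A Ak Amax].
exists A; move: Ak; rewrite inE /chromatic_number; case: ex_minnP => c.
move=> /existsP[g /forallP gP] _ ck.
exists (fun v => if insub v is Some u then inord (g u) else ord0).
split; first by rewrite /alpha Amax.
move=> u v uA vA uv; rewrite !insubT; apply/eqP => /(congr1 (@nat_of_ord _)).
rewrite !inordK ?(leq_trans (ltn_ord _) ck)// => /ord_inj guv.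
have /forallP/(_ (Sub v vA))/implyP := gP (Sub u uA).
by rewrite /= /induced_adj /= uv => /(_ isT); rewrite guv eqxx.
Qed.

Lemma leq_alpha (H : sgraph) (k : nat) (A : {set H}) (f : H -> 'I_k) :
  proper_on A f -> (#|A| <= alpha k H)%N.
Proof.
move=> fA; apply: leq_bigmax_cond; rewrite /chromatic_number.
case: ex_minnP => c _; apply; apply/existsP.
exists [ffun x : induced A => f (val x)].
apply/forallP => x; apply/forallP => y; apply/implyP => xy; rewrite !ffunE.
exact: fA (valP x) (valP y) xy.
Qed.

Lemma alpha_le (H : sgraph) (k : nat) : (alpha k H <= #|H|)%N.
Proof. by apply/bigmax_leqP => X _; apply: max_card. Qed.

Lemma tauP (H : sgraph) : exists2 X : {set H}, vertex_cover X & #|X| = tau H.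
Proof.
rewrite /tau; case: arg_minnP => [|X cX _]; last by exists X.
by apply/forallP => x; apply/forallP => y; rewrite !inE /= implybT.
Qed.

Lemma tau_min (H : sgraph) (X : {set H}) : vertex_cover X -> (tau H <= #|X|)%N.
Proof.
rewrite /tau; case: arg_minnP => [|Y _ Ymin]; last exact: Ymin.
by apply/forallP => x; apply/forallP => y; rewrite !inE /= implybT.
Qed.

Section ModelBounds.
Variables (R : realFieldType) (H G : sgraph) (w : G -> R) (m : R).
Hypothesis model_ge : forall mu : {ffun H -> {set G}}, jumbled_model mu ->
  m <= \sum_z w z * (multiplicity mu z)%:R.

(** The complement of a minimum cover is independent and can all be sent to [x], the cover going to
    the pair: every vertex of [H] pays [w x], and only the cover also pays [w y]. *)
Lemma edge_model_bound (x y : G) : adj x y ->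
  m <= (num_vertices H)%:R * w x + (tau H)%:R * w y.
Proof.
move=> xy; have [X cX <-] := tauP H.
have nxy : x != y by apply: contraTneq xy => ->; rewrite adj_irrefl.
have cK : clique [set x; y].
  move=> a b; rewrite !inE => /orP[]/eqP-> /orP[]/eqP->; rewrite ?eqxx//.
  by rewrite adj_sym.
have := @coloring_modelP H G [set x; y] (~: X) (fun=> x) x y cK.
rewrite !inE !eqxx orbT /= => /(_ isT isT nxy (fun _ _ => isT)) mod.
have {mod}/model_ge : jumbled_model (coloring_model (~: X) (fun=> x) x y).
  apply: mod => u v; rewrite !inE => uX vX uv.
  have /forallP/(_ u)/forallP/(_ v) := cX.
  by rewrite uv (negbTE uX) (negbTE vX).
rewrite coloring_model_weight// sumr_const -cardsCs => h; apply: (le_trans h).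
rewrite -/(num_vertices H) /num_vertices -(cardsC X) natrD -mulr_natl; lra.
Qed.

Lemma set_model_bound (x y : G) (K S : {set G}) : clique K ->
  x \in K -> y \in K -> x != y -> (forall z, z \in S -> z \in K) ->
  #|S|%:R * m <= (alpha #|S| H)%:R * \sum_(z in S) w z
    + #|S|%:R * ((num_vertices H)%:R - (alpha #|S| H)%:R) * (w x + w y).
Proof.
move=> cK xK yK xy SK.
have -> : \sum_(z in S) w z = \sum_(i < #|S|) w (nth x (enum S) i).
  by rewrite -big_enum/= (big_nth x) -cardE big_mkord.
have SE : #|S| = size (enum S) by rewrite cardE.
have eK i : (i < #|S|)%N -> nth x (enum S) i \in K.
  by rewrite SE => iS; apply: SK; rewrite -mem_enum mem_nth.
have e_inj i j : (i < #|S|)%N -> (j < #|S|)%N ->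
    nth x (enum S) i = nth x (enum S) j -> i = j.
  by rewrite SE => iS jS /eqP; rewrite nth_uniq ?enum_uniq// => /eqP.
move: (#|S|) eK e_inj => [|k] eK e_inj; first by rewrite !mul0r big_ord0 mulr0 addr0.
have [A [f [<- fA]]] := alphaP H k.
(* The cyclic shifts of one assignment of colours to [S] average to uniform. *)
pose g (i : 'I_k.+1) v := nth x (enum S) (f v + i)%R.
have gm i : m <= \sum_(v in A) w (g i v)
    + ((num_vertices H)%:R - #|A|%:R) * (w x + w y).
  have /model_ge : jumbled_model (coloring_model A (g i) x y).
    apply: (coloring_modelP cK) => // [v _|u v uA vA uv]; first exact: eK.
    apply: contra (fA u v uA vA uv) => /eqP/e_inj.
    by move=> /(_ (ltn_ord _) (ltn_ord _))/ord_inj/addIr->.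
  by rewrite coloring_model_weight// natrB ?max_card.
have sumk (c : R) : \sum_(i < k.+1) c = k.+1%:R * c.
  by rewrite sumr_const card_ord mulr_natl.
rewrite -sumk; apply: (le_trans (ler_sum _ (fun i _ => gm i))).
rewrite big_split/= sumk mulrA lerD2r.
rewrite exchange_big/= mulr_natl -sumr_const ler_sum// => v _.
rewrite (reindex_inj (addrI (- f v)))/= le_eqVlt; apply/orP; left; apply/eqP.
by apply: eq_bigr => i _; rewrite /g addrA subrr add0r.
Qed.

Lemma weighted_density (C : R) : (forall z, 0 <= w z) ->
  2 * (num_vertices H)%:R <= 3 * C -> (tau H)%:R <= C ->
  (forall j, (2 <= j)%N ->
    (1 - j%:R^-1) * ((num_vertices H)%:R - (alpha j H)%:R / 2) <= C) ->
  m * \sum_(x : G) \sum_(y : G) (adj x y)%:R <= 2 * C * (num_vertices G)%:R * \sum_z w z.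
Proof.
move=> w0 nC tauC alphaC.
have all : m * \sum_(x : G) 1 * \sum_(y : G) (adj x y)%:R * 1
    <= 2 * C * (\sum_(x : G) 1) * \sum_(x : G) 1 * w x; last first.
  have <- : \sum_(x : G) 1 * w x = \sum_z w z by apply: eq_bigr => x _; rewrite mul1r.
  rewrite (eq_bigr (fun x : G => 1 * \sum_(y : G) (adj x y)%:R * 1)).
    by rewrite sumr_const in all.
  by move=> x _; rewrite mul1r; apply: eq_bigr => y _; rewrite mulr1.
apply: (@clique_support R G w m C _ (fun=> 1)) => // p p0 cl.
rewrite edge_sum_clique; last first.
  by move=> x y px py; apply: cl; rewrite lt0r ?px ?py p0.
pose K := [set x | 0 < p x].
have cK : clique K by move=> x y; rewrite !inE; exact: cl.
apply: (@clique_bound _ _ p w (fun j => (alpha j H)%:R) (num_vertices H)%:R (tau H)%:R) => //.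
- by have [X _ <-] := tauP H; rewrite ler_nat max_card.
- by move=> x y px py xy; apply: edge_model_bound; exact: cl.
- move=> x y S px py xy SK; apply: (@set_model_bound x y K) => //; rewrite ?inE//.
  by move=> z /SK; rewrite inE.
Qed.
End ModelBounds.

(** Grouping ordered adjacent pairs by the edge they span gives fibres of size two. *)
Lemma sum_adj (R : pzSemiRingType) (G : sgraph) :
  \sum_(x : G) \sum_(y : G) (adj x y)%:R = (2 * num_edges G)%:R :> R.
Proof.
transitivity ((\sum_(x : G) \sum_(y : G) adj x y)%N%:R : R).
  by rewrite natr_sum; apply: eq_bigr => x _; rewrite natr_sum.
congr (_%:R); rewrite pair_bigA /=.
rewrite (eq_bigr (fun xy : G * G => if adj xy.1 xy.2 then 1 else 0)%N); last first.
  by move=> xy _; case: adj.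
rewrite -big_mkcond/=.
rewrite (partition_big (fun xy : G * G => [set xy.1; xy.2]) (mem (edge_set G)))/=; last first.
  move=> [x y] /= xy; rewrite inE; apply/existsP; exists x; apply/existsP; exists y.
  by rewrite xy eqxx.
rewrite mulnC -sum_nat_const; apply: eq_bigr => e; rewrite inE.
move=> /existsP[a /existsP[b /andP[ab /eqP->]]].
have nab : a != b by apply: contraTneq ab => ->; rewrite adj_irrefl.
rewrite sum1_card -[RHS](_ : #|[set (a, b); (b, a)]| = 2)%N; last first.
  by rewrite cards2 xpair_eqE negb_and nab.
apply: eq_card => -[x y]; rewrite !inE !xpair_eqE unfold_in /=.
apply/andP/orP => [[xy /eqP/setP E]|].
  have := E x; have := E y; rewrite !inE !eqxx orbT.
  by move=> /esym/orP[]/eqP ya /esym/orP[]/eqP xa; move: xy; rewrite xa ya;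
     rewrite ?adj_irrefl ?eqxx//; [right|left].
by move=> [] /andP[/eqP-> /eqP->]; [|rewrite finset.setUC adj_sym]; rewrite ab eqxx.
Qed.

(** * Volume and the extremal function *)

Lemma sum_option (V : nmodType) (T : finType) (F : option T -> V) :
  \sum_t F t = F None + \sum_x F (Some x).
Proof.
rewrite (bigD1 None)//=; congr (_ + _).
rewrite (reindex_omap Some id)/=; last by case.
by apply: eq_bigl => x; rewrite eqxx.
Qed.

Section Volume.
Variable R : realType.
Local Open Scope ereal_scope.

(** Strong duality by [farkas]. Coordinate [None] carries [m] and [Some x] carries [w x]; the forms
    are [- w x] for each vertex and [m] minus the weight of each model, and [g] is
    [m beta - sum w]. *)
Lemma Vol_lower_bound (H G : sgraph) (beta : R) :
  (forall (w : G -> R) (m : R), (forall x, (0 <= w x)%R) ->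
     (forall mu : {ffun H -> {set G}}, jumbled_model mu ->
        m <= \sum_x w x * (multiplicity mu x)%:R)%R ->
     (m * beta <= \sum_x w x)%R) ->
  beta%:E <= Vol R H G.
Proof.
move=> dual.
pose P (i : G + {ffun H -> {set G}}) :=
  if i is inr mu then `[< jumbled_model mu >] else true.
pose a (i : G + {ffun H -> {set G}}) (t : option G) : R :=
  match i, t with
  | inl x, t => (- (t == Some x)%:R)%R
  | inr mu, None => 1%R
  | inr mu, Some x => (- (multiplicity mu x)%:R)%R
  end.
pose g (t : option G) : R := if t is Some _ then (-1)%R else beta.
have [||u u0 gE] := @farkas R (option G) _ [seq i <- index_enum _ | P i] a g.
- by rewrite filter_uniq// index_enum_uniq.
- move=> x xP; rewrite sum_option /=.
  under eq_bigr do rewrite mulN1r.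
  rewrite sumrN subr_le0 mulrC; apply: dual => [z|mu muP].
    have := xP (inl z); rewrite mem_filter mem_index_enum => /(_ isT).
    rewrite (bigD1 (Some z))//= eqxx mulN1r big1 ?addr0 ?oppr_le0// => i /negbTE->.
    by rewrite oppr0 mul0r.
  have := xP (inr mu); rewrite mem_filter mem_index_enum andbT => /(_ (asboolT muP)).
  rewrite sum_option /= mul1r; under eq_bigr do rewrite mulNr mulrC.
  by rewrite sumrN subr_le0.
pose s := [seq mu <- index_enum {ffun H -> {set G}} | `[< jumbled_model mu >]].
have sumE (F : {ffun H -> {set G}} -> R) :
    (\sum_(i < size s) F (tnth (in_tuple s) i) = \sum_(mu | `[< jumbled_model mu >]) F mu)%R.
  by rewrite -[RHS]big_filter -/s [RHS]big_tnth.
apply: ereal_sup_ubound; exists (size s), (fun i => u (inr (tnth (in_tuple s) i))),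
  (tnth (in_tuple s)); split.
- by move=> i; apply: u0.
- by move=> i; have := mem_tnth i (in_tuple s); rewrite mem_filter => /andP[/asboolP].
(* Coordinate [Some x] gives the packing constraint at [x], with slack [u (inl x)]. *)
- move=> x; rewrite (sumE (fun mu => u (inr mu) * (multiplicity mu x)%:R)%R).
  have := gE (Some x); rewrite big_filter big_sumType /= (bigD1 x)//= eqxx.
  rewrite big1 => [|y yx]; last first.
    by rewrite (inj_eq Some_inj) eq_sym (negbTE yx) oppr0 mulr0.
  under eq_bigr do rewrite mulrN; rewrite sumrN mulrN1; have := u0 (inl x); lra.
(* Coordinate [None] says that the multipliers of the models add up to [beta]. *)
- rewrite (sumE (fun mu => u (inr mu))); congr EFin.
  have := gE None; rewrite big_filter big_sumType /= big1 => [|y _]; last first.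
    by rewrite oppr0 mulr0.
  by rewrite add0r => ->; apply: eq_bigr => mu _; rewrite mulr1.
Qed.

(** Weak duality: sum the packing constraints with weights [w] and exchange the sums. *)
Lemma Vol_upper_bound (H G : sgraph) (w : G -> R) (k : R) :
  (forall x, (0 <= w x)%R) -> (0 < k)%R ->
  (forall mu : {ffun H -> {set G}}, jumbled_model mu ->
     k <= \sum_x w x * (multiplicity mu x)%:R)%R ->
  Vol R H G <= ((\sum_x w x) / k)%R%:E.
Proof.
move=> w0 k0 kmu; apply: ge_ereal_sup => _ [n [a [mu [a0 muP amu ->]]]].
rewrite lee_fin ler_pdivlMr// mulr_suml.
apply: (@le_trans _ _ (\sum_x w x * \sum_i a i * (multiplicity (mu i) x)%:R)%R); last first.
  by apply: ler_sum => x _; rewrite -[leRHS]mulr1 ler_wpM2l.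
under [leRHS]eq_bigr do rewrite mulr_sumr.
rewrite exchange_big/=; apply: ler_sum => i _.
under eq_bigr do rewrite mulrCA.
by rewrite -mulr_sumr ler_wpM2l// kmu.
Qed.

(** These are the reals at least [c_T(H)] and [2 v(H) / 3]; listing the terms avoids presupposing
    that [c_T(H)] is finite. *)
Definition dominates (H : sgraph) (C : R) :=
  [/\ (2 * (num_vertices H)%:R <= 3 * C)%R, ((tau H)%:R <= C)%R &
     forall j, (2 <= j)%N ->
       ((1 - j%:R^-1) * ((num_vertices H)%:R - (alpha j H)%:R / 2) <= C)%R].

Lemma density_le_Vol (H G : sgraph) (C : R) : (0 < C)%R ->
  (0 < num_vertices G)%N -> dominates H C -> (density R G / C)%R%:E <= Vol R H G.
Proof.
move=> C0 G0 [nC tauC alphaC]; apply: Vol_lower_bound => w m w0 mmu.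
have := weighted_density mmu w0 nC tauC alphaC; rewrite sum_adj natrM => h.
have v0 : (0 < (num_vertices G)%:R :> R)%R by rewrite ltr0n.
rewrite /density mulrA ler_pdivrMr// mulrA ler_pdivrMr//; lra.
Qed.

Lemma c_f_le (H : sgraph) (C : R) : (0 < C)%R -> dominates H C -> c_f R H <= C%:E.
Proof.
move=> C0 HC; apply: ge_ereal_sup => _ [G [G0 ->]].
have := density_le_Vol C0 G0 HC.
have d0 : (0 <= density R G)%R by rewrite divr_ge0.
case: (Vol R H G) => [r|_|]; last by rewrite leeNy_eq.
  2: by rewrite invey mule0 lee_fin ltW.
rewrite lee_fin => dr.
have {}dr : (density R G <= r * C)%R by rewrite -ler_pdivrMr//.
(* An edgeless [G] contributes 0 even if [r = 0]; otherwise [dr] forces [r > 0]. *)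
have [->|dN0] := eqVneq (density R G) 0%R; first by rewrite mul0e lee_fin ltW.
have r0 : (0 < r)%R.
  by rewrite -(pmulr_lgt0 _ C0); apply: lt_le_trans dr; rewrite lt0r dN0.
by rewrite inver gt_eqF// -EFinM lee_fin ler_pdivrMr// mulrC.
Qed.

(** The weight [w] bounds [Vol] from above by weak duality. An edge in [G] makes [Vol] positive, so
    that the quotient is a genuine one. *)
Lemma c_f_ge (H G : sgraph) (w : G -> R) (k : R) :
  (0 < num_edges G)%N -> (forall x, (0 <= w x)%R) -> (0 < k)%R ->
  (forall mu : {ffun H -> {set G}}, jumbled_model mu ->
     k <= \sum_x w x * (multiplicity mu x)%:R)%R ->
  (density R G * k / \sum_x w x)%R%:E <= c_f R H.
Proof.
move=> e0 w0 k0 kmu.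
have G0 : (0 < num_vertices G)%N.
  have /card_gt0P[e] := e0; rewrite inE => /existsP[x _].
  by apply/card_gt0P; exists x.
apply: (@le_trans _ _ ((density R G)%:E / Vol R H G)); last first.
  by apply: ereal_sup_ubound; exists G.
have nH : (tau H <= num_vertices H)%N by have [X _ <-] := tauP H; apply: max_card.
have d0 : (0 < density R G)%R by rewrite divr_gt0// ltr0n.
have C0 : (0 < (num_vertices H).+1%:R :> R)%R by rewrite ltr0n.
have := Vol_upper_bound w0 k0 kmu.
(* A crude constant, used only to see that [Vol R H G] is positive. *)
have := @density_le_Vol H G (num_vertices H).+1%:R C0 G0.
have domH : dominates H (num_vertices H).+1%:R.
  split; rewrite ?ler_nat ?leqW// -(natr1 (num_vertices H)); first by have := ler0n R (num_vertices H); lra.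
  move=> j j2; have n0 := ler0n R (num_vertices H); have a0 := ler0n R (alpha j H).
  have an : ((alpha j H)%:R <= (num_vertices H)%:R :> R)%R by rewrite ler_nat alpha_le.
  have : (0 <= j%:R^-1 * ((num_vertices H)%:R - (alpha j H)%:R / 2) :> R)%R.
    by rewrite mulr_ge0 ?invr_ge0//; lra.
  lra.
move=> /(_ domH).
case: (Vol R H G) => [r| |]; last by rewrite leeNy_eq.
  2: by rewrite leye_eq.
rewrite !lee_fin => dr rW.
have r0 : (0 < r)%R by apply: lt_le_trans dr; rewrite divr_gt0.
rewrite inver gt_eqF// -EFinM lee_fin -mulrA ler_pM2l//.
rewrite -[leLHS]invrK invf_div lef_pV2// posrE//; exact: lt_le_trans rW.
Qed.

(** * Lower bounds from complete graphs and stars *)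

Lemma complete_adj_sym (n : nat) : symmetric (fun x y : 'I_n => x != y).
Proof. by move=> x y; rewrite eq_sym. Qed.
Lemma complete_adj_irrefl (n : nat) : irreflexive (fun x y : 'I_n => x != y).
Proof. by move=> x; rewrite eqxx. Qed.
Definition complete (n : nat) : sgraph :=
  SGraph (@complete_adj_sym n) (@complete_adj_irrefl n).

Lemma density_complete (n : nat) : density R (complete n.+1) = (n%:R / 2)%R.
Proof.
have := sum_adj R (complete n.+1).
rewrite (eq_bigr (fun=> n%:R)) => [|x _]; last first.
  rewrite (bigD1 x)//= eqxx add0r (eq_bigr (fun=> 1%R)) => [|y yx].
    by rewrite sumr_const cardC1 card_ord.
  by rewrite eq_sym yx.
rewrite sumr_const card_ord natrM /density /num_vertices card_ord -[(_ *+ _)%R]mulr_natr => E.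
have n0 : (n.+1%:R != 0 :> R)%R by rewrite pnatr_eq0.
have -> : (num_edges (complete n.+1))%:R = (n%:R * n.+1%:R / 2 :> R)%R by lra.
by field.
Qed.

(** [None] is the centre and the ordinals are the [t] leaves. *)
Definition star_adj (t : nat) (x y : option 'I_t) := isSome x != isSome y.
Lemma star_adj_sym (t : nat) : symmetric (@star_adj t).
Proof. by move=> x y; rewrite /star_adj eq_sym. Qed.
Lemma star_adj_irrefl (t : nat) : irreflexive (@star_adj t).
Proof. by move=> x; rewrite /star_adj eqxx. Qed.
Definition star (t : nat) : sgraph := SGraph (@star_adj_sym t) (@star_adj_irrefl t).

Lemma num_edges_star (t : nat) : num_edges (star t) = t.
Proof.
apply/eqP; rewrite -(eqn_pmul2l (_ : 0 < 2)%N)// -(eqr_nat R) -sum_adj.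
rewrite sum_option (sum_option (fun y => _)) /= add0r sumr_const card_ord.
rewrite (eq_bigr (fun=> 1%R)) => [|x _]; last first.
  by rewrite sum_option big1 ?addr0.
by rewrite sumr_const card_ord mul2n -addnn natrD.
Qed.

(** Every edge of a star meets the centre, so in any model the vertices of [H] whose sets contain
    the centre form a vertex cover. Weight 1 on the centre gives [tau(H)] times a density tending to
    1. *)
Lemma tau_le_c_f (H : sgraph) : 0 <= c_f R H -> (tau H)%:R%:E <= c_f R H.
Proof.
move=> cf0; have [->//|tau0] := posnP (tau H).
have tau0R : (0 < (tau H)%:R :> R)%R by rewrite ltr0n.
apply/lee_addgt0Pr => e e0.
(* Large enough that the defect [tau(H) / (t + 1)] is at most [e]. *)
pose t := (Num.bound ((tau H)%:R / e)).
have te : ((tau H)%:R < e * t%:R)%R.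
  by rewrite mulrC -ltr_pdivrMr//; apply: archi_boundP; rewrite divr_ge0// ltW.
have t0 : (0 < t)%N by rewrite -(ltr0n R) -(pmulr_rgt0 _ e0) (lt_trans _ te).
have := @c_f_ge H (star t) (fun x => (x == None)%:R)%R (tau H)%:R%R.
rewrite num_edges_star => /(_ t0 _ tau0R); rewrite sum_option eqxx big1// addr0 divr1.
move=> /(_ (fun=> ler0n _ _)) cf; apply: (@le_trans _ _ (c_f R H + e%:E)%E) => //.
apply: (@le_trans _ _ ((density R (star t) * (tau H)%:R)%R%:E + e%:E)); last first.
  rewrite leeD2r//; apply: cf => mu [muP muA].
  rewrite sum_option eqxx mul1r big1 => [|x _]; last by rewrite mul0r.
  rewrite addr0 ler_nat; apply: tau_min; apply/forallP => u; apply/forallP => v.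
  apply/implyP => /muA[x [y [xu yv]]]; rewrite !inE /= /star_adj.
  by case: x xu => [x|] xu; case: y yv => [y|] yv; rewrite ?xu ?yv ?orbT.
rewrite -EFinD lee_fin /density num_edges_star /num_vertices card_option card_ord -natr1.
have t0R : (0 < t%:R :> R)%R by rewrite ltr0n.
have -> : (t%:R / (t%:R + 1) * (tau H)%:R
    = (tau H)%:R - (tau H)%:R / (t%:R + 1) :> R)%R.
  by field; rewrite gt_eqF// addr_gt0.
have : ((tau H)%:R / (t%:R + 1) <= e)%R.
  by rewrite ler_pdivrMr ?addr_gt0//; lra.
lra.
Qed.

(** The vertices of [H] mapped to singletons are properly coloured by their images, so there are at
    most [alpha n.+1 H] of them; all others use at least two vertices. *)
Lemma complete_model_weight (H : sgraph) (n : nat) (mu : {ffun H -> {set complete n.+1}}) :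
  jumbled_model mu -> (2 * #|H| <= alpha n.+1 H + \sum_v #|mu v|)%N.
Proof.
move=> [muP muA].
pose A := [set v | #|mu v| == 1%N].
pose f (v : H) : 'I_n.+1 := odflt ord0 [pick x in mu v].
have fE v x : v \in A -> x \in mu v -> f v = x.
  rewrite inE => /cards1P[y muv]; rewrite muv inE => /eqP->.
  by rewrite /f; case: pickP => [z|/(_ y)]; rewrite muv inE ?eqxx// => /eqP.
have fA : proper_on A f.
  move=> u v uA vA /muA[x [y [xu yv xy]]].
  by rewrite (fE u x)// (fE v y).
apply: leq_trans (leq_add (leq_alpha fA) (leqnn _)).
have -> : #|A| = (\sum_v (v \in A))%N.
  by rewrite -sum1_card big_mkcond; apply: eq_bigr => v _; case: ifP.
rewrite mulnC -sum_nat_const -big_split/= leq_sum// => v _.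
have [/set0Pn/card_gt0P v0 _] := muP v.
by rewrite inE; case: eqP => [->//|]; case: #|_| v0 => [//|[]].
Qed.

(** Uniform weight 1 has total [i + 2] on [complete i.+2], whose density is [(i + 1) / 2], and each
    model weighs at least [k = 2 v(H) - alpha]. *)
Lemma complete_le_c_f (H : sgraph) (i : nat) : 0 <= c_f R H ->
  ((i.+2%:R - 1) / i.+2%:R * ((num_vertices H)%:R - (alpha i.+2 H)%:R / 2))%R%:E
    <= c_f R H.
Proof.
(* For [H] without vertices [k] would be 0, while [c_f_ge] asks for [k > 0]. *)
move=> cf0; have [H0|H0] := posnP (num_vertices H).
  have : (alpha i.+2 H <= 0)%N by rewrite -H0 alpha_le.
  by rewrite leqn0 => /eqP->; rewrite H0 mul0r subr0 mulr0.
have an : ((alpha i.+2 H)%:R <= (num_vertices H)%:R :> R)%R by rewrite ler_nat alpha_le.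
have H0R : (0 < (num_vertices H)%:R :> R)%R by rewrite ltr0n.
have i0 : (0 < i.+1%:R :> R)%R by rewrite ltr0n.
pose k : R := (2 * (num_vertices H)%:R - (alpha i.+2 H)%:R)%R.
have e0 : (0 < num_edges (complete i.+2))%N.
  rewrite lt0n; apply/eqP => e0; have := density_complete i.+1.
  by rewrite /density e0 mul0r => /esym; apply/eqP; rewrite gt_eqF// divr_gt0.
have := @c_f_ge H (complete i.+2) (fun=> 1%R) k e0 (fun=> ler01).
rewrite density_complete sumr_const card_ord => cf.
apply: (le_trans _ (cf _ _)).
- rewrite lee_fin le_eqVlt; apply/orP; left; apply/eqP; rewrite /k -(natr1 i.+1).
  by field; rewrite nat1r natr1 pnatr_eq0.
- by rewrite /k; lra.
move=> mu muP; rewrite model_weight lerBlDl -natrM.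
rewrite (eq_bigr (fun v => (#|mu v|%:R : R)%R)) => [|v _]; last by rewrite sumr_const.
by rewrite -natr_sum -natrD ler_nat; apply: complete_model_weight.
Qed.
End Volume.

(** * Equality of the two parameters *)

Local Open Scope ereal_scope.

Theorem theorem2p5 (R : realType) (H : sgraph) :
  ((2 / 3 * (num_vertices H)%:R)%R)%:E < c_f R H -> c_f R H = c_T R H.
Proof.
move=> cf23.
have cf0 : 0 <= c_f R H.
  by apply: le_trans (ltW cf23); rewrite lee_fin mulr_ge0// divr_ge0.
apply/le_anti/andP; split; last first.
  apply: ge_ereal_sup => _ [->|[i /= i2 <-]]; first exact: tau_le_c_f.
  by case: i i2 => [|[|i]]// _; apply: complete_le_c_f.
have tau_cT : (tau H)%:R%:E <= c_T R H by apply: ereal_sup_ubound; left.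
have alpha_cT i : (2 <= i)%N ->
    ((i%:R - 1) / i%:R * ((num_vertices H)%:R - (alpha i H)%:R / 2))%R%:E <= c_T R H.
  by move=> i2; apply: ereal_sup_ubound; right; exists i.
(* The value [+oo] is trivially an upper bound, and [tau_cT] rules out [-oo]. *)
move: tau_cT alpha_cT; case: (c_T R H) => [r| |]; rewrite ?leey ?leeNy_eq//.
rewrite lee_fin => tau_r alpha_r.
have : c_f R H <= (Num.max (2 / 3 * (num_vertices H)%:R) r)%:E.
  (* The extra [e] makes the constant positive, as [c_f_le] demands. *)
  apply/lee_addgt0Pr => e e0; rewrite -EFinD.
  set C := Num.max _ _.
  have C1 : (2 / 3 * (num_vertices H)%:R <= C)%R by rewrite le_max lexx.
  have C2 : (r <= C)%R by rewrite le_max lexx orbT.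
  have n0 := ler0n R (num_vertices H).
  apply: c_f_le; first by lra.
  split; [lra|lra|move=> j j2].
  have := alpha_r j j2; rewrite lee_fin mulrBl mul1r divff; first lra.
  by rewrite pnatr_eq0; case: j j2.
(* If the maximum were [2/3 v(H)], the bound would contradict [cf23]. *)
rewrite maxEle; case: ifP => // _ h.
by have := lt_le_trans cf23 h; rewrite ltxx.
Qed.
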